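(* Let $G\in\mathcal{G}$, with cliques on $X=\{x_1,\ldots,x_m\}$ and $Y=\{y_1,\ldots,y_n\}$ ($n\ge m$), be such that at most $n-m$ vertices of $Y$ have a neighbour in $X$. If $G$ is connected and either $n$ or $m$ is even, then $T_2(G)$ is not well-covered.
   Context: $\mathcal{G}$ is the class of graphs obtained by taking the disjoint union of a complete graph $K_m$ with vertex set $X=\{x_1,\ldots,x_m\}$ and a complete graph $K_n$ with vertex set $Y=\{y_1,\ldots,y_n\}$, where $n\geq m$, and then adding some (possibly no) edges each joining a vertex of $X$ to a vertex of $Y$. The $2$-token graph $T_2(G)$ has as vertices the $2$-subsets of $V(G)$, two of them adjacent if their symmetric difference is an edge of $G$. A graph is well-covered if all of its maximal (with respect to inclusion) independent sets have the same cardinality. *)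

(* Defs.v *)
From HB Require Import structures.
From mathcomp Require Import all_boot.

Set Implicit Arguments.
Unset Strict Implicit.
Unset Printing Implicit Defensive.

Record sgraph := SGraph {
  vertex :> finType;
  adj : rel vertex;
  adj_sym : symmetric adj;
  adj_irrefl : irreflexive adj
}.

Definition clique (G : sgraph) (A : {set G}) : Prop :=
  {in A &, forall x y, x != y -> adj x y}.

Definition connected (G : sgraph) : Prop :=
  (0 < #|G|) /\ forall x y : G, connect (@adj G) x y.

Definition independent (G : sgraph) (S : {set G}) : bool :=
  [forall x in S, forall y in S, ~~ adj x y].

Definition maximal_independent (G : sgraph) (S : {set G}) : bool :=
  maxset (@independent G) S.

Definition well_covered (G : sgraph) : Prop :=
  forall S1 S2 : {set G},
    maximal_independent S1 -> maximal_independent S2 -> #|S1| = #|S2|.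

Section TokenGraph.

Variable G : sgraph.

Definition token2 : finType := {A : {set G} | #|A| == 2}.

Definition symdiff (A B : {set G}) : {set G} := (A :\: B) :|: (B :\: A).

Definition token2_adj : rel token2 := fun A B =>
  [exists u, exists v, adj u v && (symdiff (val A) (val B) == [set u; v])].

Lemma token2_adj_sym : symmetric token2_adj.
Proof.
move=> A B; apply: eq_existsb => u; apply: eq_existsb => v.
by rewrite /symdiff setUC.
Qed.

Lemma token2_adj_irrefl : irreflexive token2_adj.
Proof.
move=> A; apply/negbTE/existsP => -[u /existsP [v /andP [_ /eqP]]].
by rewrite /symdiff setDv setU0 => /setP/(_ u); rewrite !inE eqxx.
Qed.

Definition token_graph2 : sgraph := SGraph token2_adj_sym token2_adj_irrefl.

End TokenGraph.

(* The vertex set is split into two nonempty cliques [X] and [Y], the edges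
   between them being arbitrary.  Complete graphs have at least one vertex:
   for [X] empty the graph is complete, and then its 2-token graph (the line
   graph of a complete graph) is well-covered. *)
Definition two_clique_graph (G : sgraph) (X Y : {set G}) (m n : nat) : Prop :=
  [/\ X :|: Y = [set: G], [disjoint X & Y],
      #|X| = m /\ #|Y| = n,
      clique X /\ clique Y
    & 0 < m <= n].

Definition has_neighbour_in (G : sgraph) (X : {set G}) (y : G) : bool :=
  [exists x in X, adj x y].

(* Main.v *)
(** A set of 2-subsets of [G] is independent in the token graph iff, for every
    vertex [a], the vertices paired with [a] are pairwise non-adjacent.  With
    cliques [X] and [Y] it is thus a union of a matching inside [X], one inside
    [Y] and one between [X] and [Y], so it has at most [m/2 + n/2 + m] members
    (with halves rounded down).  This bound is attained because at least [m]
    vertices of [Y] have no neighbour in [X], so that they can be matched with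
    [X] without obstructing the inner matchings.  On the other hand, let [Z] be
    the clique of even order, [z0] a vertex of [Z] adjacent to some [w] outside
    [Z], and [z1] another vertex of [Z].  The pair [{z1, w}] together with a
    perfect matching of [Z \ {z0, z1}] excludes [{z0, z1}], so a maximal
    independent set containing them has fewer than [#|Z|/2] pairs inside [Z]
    and misses the bound. *)

Require Import Defs.
From mathcomp Require Import all_boot.
From mathcomp Require Import zify.

(** * Independent sets of the token graph as families of pairs of vertices *)

Definition pairs {T : finType} (E : {set {set T}}) : Prop :=
  forall A, A \in E -> #|A| = 2.

(** Independence in the token graph, read on plain vertex sets: two pairs are adjacent exactly when
    they share one vertex and their other vertices are adjacent. The case [b = c] is harmless since
    [adj] is irreflexive. *)
Definition stable {G : sgraph} (E : {set {set G}}) : Prop :=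
  forall a b c : G, [set a; b] \in E -> [set a; c] \in E -> ~~ adj b c.

Lemma adj_neq (G : sgraph) (a b : G) : adj a b -> a != b.
Proof. by apply: contraTneq => ->; rewrite adj_irrefl. Qed.

Lemma set2_injr (T : finType) (a b c : T) :
  #|[set a; b]| = 2 -> [set a; b] = [set a; c] -> b = c.
Proof.
rewrite cards2 => nab /setP /(_ b); rewrite !inE eqxx orbT => /esym.
by case/orP=> /eqP // ba; rewrite ba eqxx in nab.
Qed.

Lemma token2_adjP (G : sgraph) (A B : token2 G) :
  reflect (exists a b c, [/\ val A = [set a; b], val B = [set a; c] & adj b c])
          (token2_adj A B).
Proof.
have /eqP cA := valP A; have /eqP cB := valP B.
rewrite /token2_adj; move: (val A) (val B) cA cB => {}A {}B cA cB.
apply: (iffP existsP) => [[u /existsP [v /andP [uv /eqP dAB]]]|].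
  have nuv := adj_neq _ _ _ uv.
  (* Two 2-sets whose differences have total size 2 share exactly one vertex; this is the common
     [a]. *)
  have c2 : #|A :\: B| + #|B :\: A| = 2.
    have : #|symdiff A B| = 2 by rewrite dAB cards2 nuv.
    rewrite /symdiff cardsU (_ : _ :&: _ = set0) ?cards0 ?subn0 //.
    by apply/setP=> z; rewrite !inE; case: (z \in _); case: (z \in _).
  have := cardsID (B) (A); have := cardsID (A) (B).
  rewrite setIC cA cB => e1 e2.
  have /eqP/cards1P [a aE] : #|A :&: B| = 1 by lia.
  have /eqP/cards1P [b bE] : #|A :\: B| = 1 by lia.
  have /eqP/cards1P [c cE] : #|B :\: A| = 1 by lia.
  exists a, b, c; split.
  - by rewrite -aE -bE setID.
  - by rewrite -aE -cE setIC setID.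
  move: dAB; rewrite /symdiff bE cE => /setP dAB.
  have := dAB u; have := dAB v; rewrite !inE !eqxx orbT.
  case/orP=> /eqP vE /orP[] /eqP uE; subst => //; try by rewrite eqxx in nuv.
  by rewrite adj_sym.
move=> [a [b [c [AE BE bc]]]]; exists b; apply/existsP; exists c.
rewrite bc /=; apply/eqP/setP => z; rewrite /symdiff AE BE !inE.
have nbc := adj_neq _ _ _ bc.
move: cA cB; rewrite AE BE !cards2.
case: (eqVneq a b) => // nab _; case: (eqVneq a c) => // nac _.
have [->|nza] := eqVneq z a; first by rewrite (negPf nab) (negPf nac).
rewrite /=; have [->|] := eqVneq z b; first by rewrite (negPf nbc).
by case: (z == c).
Qed.

Lemma independent_stable (G : sgraph) (S : {set token_graph2 G}) :
  independent S <-> stable (val @: S).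
Proof.
split=> [/forall_inP iS a b c /imsetP [A AS AE] /imsetP [B BS BE]|sS].
  apply: contra (forall_inP (iS A AS) B BS) => bc.
  by apply/token2_adjP; exists a, b, c.
apply/forall_inP => A AS; apply/forall_inP => B BS.
apply/token2_adjP => -[a [b [c [AE BE]]]]; apply/negP.
by apply: (sS a); rewrite -?AE -?BE imset_f.
Qed.

Lemma pairs_token_set (G : sgraph) (E : {set {set G}}) :
  pairs E -> exists S : {set token_graph2 G}, val @: S = E.
Proof.
move=> pE; exists [set A : token_graph2 G | val A \in E].
apply/setP => A; apply/imsetP/idP => [[B] | AE]; first by rewrite inE => ? ->.
have cA : #|A| == 2 by apply/eqP/pE.
by exists (Sub A cA : token2 G); rewrite ?inE SubK.
Qed.

Lemma token_set_pairs (G : sgraph) (S : {set token_graph2 G}) : pairs (val @: S).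
Proof. by move=> _ /imsetP [A _ ->]; apply/eqP/(valP A). Qed.

(** Allows a maximal independent set to be prescribed by only some of its pairs. *)
Lemma maximal_independent_extension (G : sgraph) (E : {set {set G}}) :
  pairs E -> stable E ->
  exists2 S : {set token_graph2 G}, maximal_independent S & E \subset val @: S.
Proof.
move=> /pairs_token_set [S0 <-] /independent_stable iS0.
have [S mS S0S] := maxset_exists iS0.
by exists S => //; apply: imsetS.
Qed.

(** * Matchings as disjoint families of pairs *)

Lemma pairs_setU (T : finType) (E F : {set {set T}}) :
  pairs E -> pairs F -> pairs (E :|: F).
Proof. by move=> pE pF A /setUP [/pE|/pF]. Qed.

Lemma card_cover_pairs (T : finType) (P : {set {set T}}) :
  pairs P -> trivIset P -> #|cover P| = #|P|.*2.
Proof.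
by move=> pP /eqP <-; rewrite (eq_bigr (fun=> 2)) // sum_nat_const muln2.
Qed.

(** A matching, not necessarily perfect, of the complete graph on [A]. *)
Definition packing {T : finType} (P : {set {set T}}) (A : {set T}) : Prop :=
  [/\ pairs P, trivIset P & cover P \subset A].

Lemma packing_setU {T : finType} {P Q : {set {set T}}} {A B : {set T}} :
  packing P A -> packing Q B -> [disjoint A & B] ->
  packing (P :|: Q) (A :|: B) /\ #|P :|: Q| = #|P| + #|Q|.
Proof.
move=> [pP tP cP] [pQ tQ cQ] dAB.
have dPQ : [disjoint cover P & cover Q].
  exact: disjointWl cP (disjointWr cQ dAB).
have dPQ' C D : C \in P -> D \in Q -> [disjoint C & D].
  move=> CP DQ; apply: disjointWl (bigcup_sup C CP) _.
  exact: disjointWr (bigcup_sup D DQ) dPQ.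
split; last first.
  rewrite cardsU (_ : P :&: Q = set0) ?cards0 ?subn0 //.
  apply/setP => C; rewrite !inE; apply/negP => /andP [CP CQ].
  have := dPQ' C C CP CQ; rewrite -setI_eq0 setIid => /eqP C0.
  by have := pP C CP; rewrite C0 cards0.
split; first exact: pairs_setU.
  apply/trivIsetP => C D /setUP [CP|CQ] /setUP [DP|DQ] nCD.
  - exact: (trivIsetP tP).
  - exact: dPQ'.
  - by rewrite disjoint_sym dPQ'.
  - exact: (trivIsetP tQ).
by rewrite /cover bigcup_setU setUSS.
Qed.

Lemma packing_set2 (T : finType) (a b : T) :
  a != b -> packing [set [set a; b]] [set a; b].
Proof.
move=> nab; split; first by move=> _ /set1P ->; rewrite cards2 nab.
  by apply/trivIsetP => C D /set1P -> /set1P ->; rewrite eqxx.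
by rewrite /cover big_set1.
Qed.

Lemma packing_exists (T : finType) (A : {set T}) :
  exists2 P, packing P A & #|P| = #|A|./2.
Proof.
have [k] := ubnP #|A|; elim: k A => // k IHk A leA.
have [A1|/card_gt1P [a [b [aA bA nab]]]] := leqP #|A| 1.
  exists set0; last by rewrite cards0; lia.
  split; first by [move=> C; rewrite inE].
    by apply/trivIsetP => C D; rewrite inE.
  by rewrite /cover big_set0 sub0set.
have sabA : [set a; b] \subset A by rewrite subUset !sub1set aA.
have cA : #|A :\: [set a; b]| + 2 = #|A|.
  by rewrite -(cardsID [set a; b] A) (setIidPr sabA) cards2 nab addnC.
have [|P hP cP] := IHk (A :\: [set a; b]); first by lia.
have [] := packing_setU (packing_set2 _ a b nab) hP.
  by rewrite -setI_eq0 setIDA setIC -setIDA setDv setI0.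
rewrite -{2}(setIidPr sabA) setID cards1 cP => hU cU.
by exists ([set [set a; b]] :|: P) => //; rewrite cU; lia.
Qed.

Lemma perfect_packing_cover (T : finType) (P : {set {set T}}) (A : {set T}) :
  packing P A -> #|P| = #|A|./2 -> ~~ odd #|A| -> cover P = A.
Proof.
move=> [pP tP sPA] cP eA; apply/eqP.
rewrite eqEcard sPA card_cover_pairs // cP; lia.
Qed.

Lemma packing_leq (T : finType) (P : {set {set T}}) (A : {set T}) :
  packing P A -> #|P| <= #|A|./2.
Proof.
move=> [pP tP /subset_leq_card]; rewrite card_cover_pairs //; lia.
Qed.

Lemma packing_set2_inj (T : finType) (P : {set {set T}}) (A : {set T}) (a b c : T) :
  packing P A -> [set a; b] \in P -> [set a; c] \in P -> b = c.
Proof.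
move=> [pP tP _] abP acP; apply: (set2_injr _ a); first exact: pP.
apply: contraTeq (set21 a b) => nbc.
by rewrite (disjointFl (trivIsetP tP _ _ abP acP nbc)) // set21.
Qed.

(** * Upper bound on the size of a stable family *)

(** If two distinct pairs inside [Z] shared a vertex, their other vertices would be distinct members
    of a clique, hence adjacent, against stability. *)
Lemma stable_clique_packing (G : sgraph) (E : {set {set G}}) (Z : {set G}) :
  clique Z -> pairs E -> stable E ->
  packing [set A in E | A \subset Z] Z.
Proof.
move=> kZ pE sE; split.
- by move=> A; rewrite inE => /andP [/pE].
- apply/trivIsetP => A B; rewrite !inE => /andP [AE AZ] /andP [BE BZ] nAB.
  rewrite -setI_eq0; apply: contraNT nAB => /set0Pn [a /setIP [aA aB]].
  have /eqP/cards1P [b bE] : #|A :\ a| = 1.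
    by have := cardsD1 a A; rewrite aA pE //; lia.
  have /eqP/cards1P [c cE] : #|B :\ a| = 1.
    by have := cardsD1 a B; rewrite aB pE //; lia.
  have AE' : A = [set a; b] by rewrite -bE setD1K.
  have BE' : B = [set a; c] by rewrite -cE setD1K.
  have [ebc|nbc] := eqVneq b c; first by rewrite AE' BE' ebc.
  rewrite AE' in AE; rewrite BE' in BE; case/negP: (sE a b c AE BE).
  apply: kZ nbc; first by apply: (subsetP AZ); rewrite AE' !inE eqxx orbT.
  by apply: (subsetP BZ); rewrite BE' !inE eqxx orbT.
by apply/bigcupsP => A; rewrite inE => /andP [].
Qed.

(** Each crossing pair is determined by its end in [X]: two of them with the same end there would
    have distinct, hence adjacent, ends in the clique [Y]. So there are at most [#|X|] crossing
    pairs. *)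
Lemma stable_card_leq (G : sgraph) (X Y : {set G}) (E : {set {set G}}) :
  X :|: Y = [set: G] -> [disjoint X & Y] -> clique Y ->
  pairs E -> stable E ->
  #|E| <= #|[set A in E | A \subset X]| + #|[set A in E | A \subset Y]| + #|X|.
Proof.
move=> XY dXY kY pE sE.
pose C := [set A in E | ~~ (A \subset X) && ~~ (A \subset Y)].
have XorY z : z \notin X -> z \in Y.
  by move=> zX; have := in_setT z; rewrite -XY inE (negPf zX).
have EU : E \subset [set A in E | A \subset X] :|: [set A in E | A \subset Y] :|: C.
  by apply/subsetP=> A AE; rewrite !inE AE /=; case: (_ \subset _); case: (_ \subset _).
apply: leq_trans (subset_leq_card EU) _.
have lecU (A B : {set {set G}}) : #|A :|: B| <= #|A| + #|B| by rewrite cardsU leq_subr.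
apply: leq_trans (lecU _ _) _; apply: leq_add (lecU _ _) _.
have crossP A : A \in C -> exists x y, [/\ x \in X, y \in Y & A = [set x; y]].
  rewrite inE => /and3P [AE /subsetPn [y yA yX] /subsetPn [x xA xY]].
  have xX : x \in X by apply: contraR xY => /XorY.
  exists x, y; split=> //; first exact: XorY.
  apply/esym/eqP; rewrite eqEcard subUset !sub1set xA yA pE //= cards2.
  by case: eqP => // xy; rewrite -xy xX in yX.
(* The end in [X] is returned as a singleton, so that [set0] can serve as default; by [gE] the
   default is never reached on crossing pairs. *)
pose g (A : {set G}) := if [pick x in A :&: X] is Some x then [set x] else set0.
have gE x y : x \in X -> y \in Y -> g [set x; y] = [set x].
  move=> xX yY; rewrite /g; case: pickP => [z|/(_ x)]; last by rewrite !inE eqxx xX.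
  rewrite !inE => /andP [/orP[] /eqP -> //].
  by move=> yX; have := disjointFr dXY yX; rewrite yY.
rewrite -(card_in_imset (f := g)); last first.
  move=> A B hA hB; move: (hA) (hB); rewrite !inE => /andP [AE _] /andP [BE _].
  have [x [y [xX yY AE']]] := crossP A hA; have [x' [y' [xX' yY' BE']]] := crossP B hB.
  rewrite AE' BE' !gE // => /set1_inj xx; rewrite -xx in BE' *.
  have [-> //|nyy] := eqVneq y y'.
  rewrite AE' in AE; rewrite BE' in BE.
  by case/negP: (sE x y y' AE BE); apply: kY.
rewrite -(card_imset X (@set1_inj G)); apply: subset_leq_card.
apply/subsetP => _ /imsetP [A /crossP [x [y [xX yY ->]]] ->].
by rewrite gE // imset_f.
Qed.

(** * A maximal independent set with too few pairs inside an even clique *)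

Lemma deficient_maximal_independent (G : sgraph) (Z : {set G}) (z0 z1 w : G) :
  clique Z -> ~~ odd #|Z| -> z0 \in Z -> z1 \in Z -> z0 != z1 -> w \notin Z ->
  adj z0 w ->
  exists2 S : {set token_graph2 G}, maximal_independent S
    & #|[set A in val @: S | A \subset Z]| < #|Z|./2.
Proof.
move=> kZ eZ z0Z z1Z nz wZ z0w.
pose Z' := Z :\: [set z0; z1].
have sZ : [set z0; z1] \subset Z by rewrite subUset !sub1set z0Z.
have cZ : #|Z'| + 2 = #|Z|.
  by rewrite -(cardsID [set z0; z1] Z) (setIidPr sZ) cards2 nz addnC.
have [P hP cP] := packing_exists _ Z'.
have eZ' : ~~ odd #|Z'| by lia.
have covP := perfect_packing_cover _ _ _ hP cP eZ'.
have nz1w : z1 != w by apply: contraNneq wZ => <-.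
have [] := packing_setU (packing_set2 _ z1 w nz1w) hP.
  rewrite -setI_eq0; apply/eqP/setP => z; rewrite !inE.
  have [->|] := eqVneq z z1; first by rewrite orbT.
  by have [->|] := eqVneq z w; rewrite ?(negPf wZ) ?andbF.
move=> hE _; have [pE _ _] := hE.
have [|S mS ES] := maximal_independent_extension _ _ pE.
  move=> a b c abE acE.
  by rewrite (packing_set2_inj _ _ _ _ _ _ hE abE acE) adj_irrefl.
exists S => //.
have /independent_stable sS := maxsetp mS.
have pS := token_set_pairs _ S.
(* It is enough that the extension adds no pair inside [Z], because [P] has only [#|Z|./2 - 1]
   pairs. *)
suff /subset_leq_card : [set A in val @: S | A \subset Z] \subset P.
  rewrite cP => /leq_ltn_trans; apply; rewrite -cZ; lia.
have [_ tS _] := stable_clique_packing _ _ _ kZ pS sS.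
apply/subsetP => A AS; move: (AS); rewrite inE => /andP [AS' AZ].
(* The only candidate disjoint from [Z'] is [{z0, z1}]; it conflicts with [{z1, w}], as [z0] and [w]
   are adjacent. *)
have [sA|/subsetPn [z zA zn]] := boolP (A \subset [set z0; z1]).
  have AE : A = [set z1; z0].
    by apply/eqP; rewrite setUC eqEcard sA (pS _ AS') cards2 nz.
  rewrite AE in AS'; have z1S : [set z1; w] \in val @: S.
    by apply: (subsetP ES); rewrite !inE eqxx.
  by have := sS _ _ _ AS' z1S; rewrite z0w.
(* Otherwise [A] meets a pair [B] of [P], and pairs of [S] inside the clique [Z] are disjoint or
   equal. *)
have : z \in cover P by rewrite covP inE zn (subsetP AZ).
case/bigcupP => B BP zB; suff -> : A = B by [].
have BS : B \in [set A in val @: S | A \subset Z].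
  rewrite inE (subsetP ES) ?inE ?BP ?orbT //=.
  apply: subset_trans (bigcup_sup B BP) _.
  by have [_ _ /subset_trans-> //] := hP; apply: subsetDl.
apply: contraTeq zB => nAB.
by rewrite (disjointFr (trivIsetP tS _ _ AS BS nAB) zA).
Qed.

(** * A maximal independent set attaining the bound *)

Lemma injection_exists (T : finType) (A B : {set T}) :
  #|A| <= #|B| -> exists2 f : T -> T, {in A &, injective f} & {in A, forall x, f x \in B}.
Proof.
move=> leAB; exists (fun x => nth x (enum B) (index x (enum A))).
  have lt x : x \in A -> index x (enum A) < size (enum B).
    by move=> xA; rewrite -cardE (leq_trans _ leAB) // cardE index_mem mem_enum.
  (* The default of [nth] is the argument itself, so it must be made common to [x] and [y] before
     comparing positions. *)
  move=> x y xA yA; rewrite (set_nth_default y) ?lt // => /eqP.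
  rewrite nth_uniq ?lt ?enum_uniq // => /eqP exy.
  by rewrite -(nth_index x (s := enum A) (x := x)) ?mem_enum // exy nth_index ?mem_enum.
move=> x xA; rewrite -mem_enum mem_nth //.
by rewrite -cardE (leq_trans _ leAB) // cardE index_mem mem_enum.
Qed.


(** Conflicts can only arise at a vertex lying in both an inner and a crossing pair: [{x, b}] in [P]
    against [{x, f x}] requires [b] and [f x] non-adjacent, and [{f x, y}] in [Q] against [{f x, x}]
    requires [x] and [y] non-adjacent. The hypotheses on [cover P] and on [Q] guarantee this, while
    injectivity of [f] keeps the crossing pairs disjoint. *)
Lemma stable_packings_cross (G : sgraph) (X Y : {set G}) (f : G -> G)
    (P Q : {set {set G}}) :
  X :|: Y = [set: G] -> [disjoint X & Y] ->
  packing P X -> packing Q Y ->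
  {in X &, injective f} -> {in X, forall x, f x \in Y} ->
  {in cover P, forall x, ~~ has_neighbour_in X (f x)} ->
  (forall x y, x \in X -> [set f x; y] \in Q -> ~~ has_neighbour_in X y) ->
  let E := P :|: Q :|: [set [set x; f x] | x in X] in
  [/\ pairs E, stable E & #|E| = #|P| + #|Q| + #|X|].
Proof.
move=> XY dXY hP hQ injf fY fP fQ E.
have [pP tP cP] := hP; have [pQ tQ cQ] := hQ.
have XnY x : x \in X -> x \in Y = false by move=> xX; apply: disjointFr dXY xX.
have sP A : A \in P -> A \subset X.
  by move=> AP; apply: subset_trans (bigcup_sup A AP) cP.
have sQ A : A \in Q -> A \subset Y.
  by move=> AQ; apply: subset_trans (bigcup_sup A AQ) cQ.
have nX x y : x \in X -> ~~ has_neighbour_in X y -> ~~ adj x y.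
  by move=> xX; apply: contra => xy; apply/exists_inP; exists x.
have crossX x y a b : x \in X -> y \in Y -> a \in X -> [set a; b] = [set x; y] ->
    a = x /\ b = y.
  move=> xX yY aX eab; have : a \in [set x; y] by rewrite -eab set21.
  rewrite !inE => /orP [/eqP ax | /eqP ay]; last by rewrite -ay XnY in yY.
  split=> //; rewrite ax in eab; apply: (set2_injr _ x) => //.
  by rewrite eab cards2; case: eqP => // xy; rewrite -xy XnY in yY.
have nbX a b : a \in X -> [set a; b] \in E ->
    (b \in X /\ [set a; b] \in P) \/ b = f a.
  move=> aX /setUP [/setUP [abP|abQ]|/imsetP [x xX abE]].
  - by left; split=> //; apply: (subsetP (sP _ abP)); rewrite set22.
  - by have := subsetP (sQ _ abQ) _ (set21 a b); rewrite XnY.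
  - by have [-> ->] := crossX _ _ _ _ xX (fY x xX) aX abE; right.
have nbY a b : a \in Y -> [set a; b] \in E ->
    (b \in Y /\ [set a; b] \in Q) \/ (b \in X /\ a = f b).
  move=> aY /setUP [/setUP [abP|abQ]|/imsetP [x xX abE]].
  - by have := XnY _ (subsetP (sP _ abP) _ (set21 a b)); rewrite aY.
  - by left; split=> //; apply: (subsetP (sQ _ abQ)); rewrite set22.
  right; have : x \in [set a; b] by rewrite abE set21.
  rewrite !inE => /orP [/eqP xa | /eqP xb]; first by rewrite -xa XnY in aY.
  rewrite setUC -xb in abE *.
  by have [] := crossX _ _ _ _ xX (fY x xX) xX abE.
have pC : pairs [set [set x; f x] | x in X].
  move=> _ /imsetP [x xX ->]; rewrite cards2; case: eqP => // xf.
  by have := fY x xX; rewrite -xf XnY.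
split; first exact: pairs_setU (pairs_setU _ _ _ pP pQ) pC.
  move=> a b c abE acE; have := in_setT a; rewrite -XY => /setUP [aX|aY].
    have aP z : [set a; z] \in P -> ~~ has_neighbour_in X (f a).
      by move=> azP; apply: fP; apply/bigcupP; exists [set a; z]; rewrite ?set21.
    case: (nbX _ _ aX abE) => [[bX abP]|->]; case: (nbX _ _ aX acE) => [[cX acP]|->].
    - by rewrite (packing_set2_inj _ _ _ _ _ _ hP abP acP) adj_irrefl.
    - by apply: nX => //; apply: aP abP.
    - by rewrite adj_sym; apply: nX => //; apply: aP acP.
    - by rewrite adj_irrefl.
  case: (nbY _ _ aY abE) => [[bY abQ]|[bX ab]];
    case: (nbY _ _ aY acE) => [[cY acQ]|[cX ac]].
  - by rewrite (packing_set2_inj _ _ _ _ _ _ hQ abQ acQ) adj_irrefl.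
  - by rewrite adj_sym; apply: nX => //; apply: fQ cX _; rewrite -ac.
  - by apply: nX => //; apply: fQ bX _; rewrite -ab.
  - have -> : b = c by apply: injf => //; rewrite -ab.
    by rewrite adj_irrefl.
have [_ cPQ] := packing_setU hP hQ dXY.
rewrite /E cardsU cPQ card_in_imset; last first.
  move=> x x' xX xX' /(crossX _ _ _ _ xX' (fY x' xX') xX) [] //.
rewrite (_ : _ :&: _ = set0) ?cards0 ?subn0 //.
apply/setP => A; rewrite [A \in set0]inE; apply/negP.
case/setIP => /setUP [/sP sA|/sQ sA] /imsetP [x xX AE].
  by have := subsetP sA (f x); rewrite AE set22 => /(_ isT) /XnY; rewrite fY.
by have := subsetP sA x; rewrite AE set21 XnY // => /(_ isT).
Qed.

(** Without a crossing edge [X] would be closed under adjacency, so no path could lead from [X] to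
    [Y]. *)
Lemma connected_cross_edge (G : sgraph) (X Y : {set G}) :
  connected G -> X :|: Y = [set: G] -> [disjoint X & Y] ->
  0 < #|X| -> 0 < #|Y| -> exists x y, [/\ x \in X, y \in Y & adj x y].
Proof.
move=> [_ conn] XY dXY /card_gt0P [x xX] /card_gt0P [y yY].
have [/exists_inP [a aX /exists_inP [b bY ab]]|noadj] :=
  boolP [exists a in X, exists b in Y, adj a b]; first by exists a, b.
have clX : closed (@adj G) (mem X).
  apply: intro_closed => [|a b ab aX]; first exact: sym_connect_sym (@adj_sym G).
  have := in_setT b; rewrite -XY => /setUP [] // bY; case/negP: noadj.
  by apply/exists_inP; exists a => //; apply/exists_inP; exists b.
by have := closed_connect clX (conn x y); rewrite /= xX (disjointFl dXY yY).
Qed.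

Lemma full_maximal_independent (G : sgraph) (X Y : {set G}) (x0 y0 : G) :
  X :|: Y = [set: G] -> [disjoint X & Y] ->
  #|X| <= #|[set y in Y | ~~ has_neighbour_in X y]| ->
  x0 \in X -> y0 \in Y -> adj x0 y0 -> ~~ odd #|Y| \/ ~~ odd #|X| ->
  exists2 S : {set token_graph2 G}, maximal_independent S
    & #|X|./2 + #|Y|./2 + #|X| <= #|S|.
Proof.
move=> XY dXY /injection_exists [f injf fY'] x0X y0Y x0y0 heven.
have fY x : x \in X -> f x \in Y by move/fY'; rewrite inE => /andP [].
have fN x : x \in X -> ~~ has_neighbour_in X (f x).
  by move/fY'; rewrite inE => /andP [].
suff [E [pE sE cE]] : exists E : {set {set G}},
    [/\ pairs E, stable E & #|X|./2 + #|Y|./2 + #|X| <= #|E|].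
  have [S mS ES] := maximal_independent_extension _ _ pE sE.
  exists S => //; rewrite -(card_imset _ val_inj).
  exact: leq_trans cE (subset_leq_card ES).
have [oX|eX] := boolP (odd #|X|); last first.
  (* For [#|X|] even, [T] is matched within itself, so that partners of vertices [f x] also lack
     neighbours in [X]. As [#|T|] is even, matching [T] and [Y :\: T] separately still yields
     [#|Y|./2] pairs. *)
  pose T := f @: X.
  have TY : T \subset Y by apply/subsetP => _ /imsetP [x xX ->]; apply: fY.
  have cT : #|T| = #|X| by apply: card_in_imset.
  have cYT : #|Y :\: T| + #|X| = #|Y|.
    by rewrite -(cardsID T Y) (setIidPr TY) cT addnC.
  have [P hP cP] := packing_exists _ X.
  have [Q1 hQ1 cQ1] := packing_exists _ T.
  have [Q2 hQ2 cQ2] := packing_exists _ (Y :\: T).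
  have [] := packing_setU hQ1 hQ2.
    by rewrite -setI_eq0 setIDA setIC -setIDA setDv setI0.
  rewrite -{1}(setIidPr TY) setID => hQ cQ.
  have [] := stable_packings_cross _ _ _ f _ _ XY dXY hP hQ injf fY.
  - by move=> x xP; apply: fN; apply: subsetP x xP; case: hP.
  - move=> x y xX /setUP [yQ|yQ].
      have [_ _ /subsetP sQ1] := hQ1.
      have /imsetP [z zX ->] : y \in T.
        by apply: sQ1; apply/bigcupP; exists [set f x; y]; rewrite ?set22.
      exact: fN.
    have [_ _ /subsetP sQ2] := hQ2.
    have : f x \in Y :\: T.
      by apply: sQ2; apply/bigcupP; exists [set f x; y]; rewrite ?set21.
    by rewrite inE imset_f.
  move=> pE sE cE; eexists; split; [exact: pE|exact: sE|].
  rewrite cE cP cQ cQ1 cQ2 cT; lia.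
have eY : ~~ odd #|Y| by case: heven => //; rewrite oX.
have y0N : has_neighbour_in X y0 by apply/exists_inP; exists x0.
(* Since #|X| is odd, x0 may stay unmatched in X; sending it to y0 frees f x0
   to be the partner of y0 in Y. *)
pose T := f @: (X :\ x0); pose D := [set f x0; y0].
have nfy : f x0 != y0 by apply: contraTneq y0N => <-; apply: fN.
have TY : T \subset Y.
  by apply/subsetP => _ /imsetP [x /setD1P [_ xX] ->]; apply: fY.
have cX : #|X| = #|X :\ x0|.+1 by rewrite (cardsD1 x0 X) x0X.
have cT : #|T| = #|X :\ x0|.
  by apply: card_in_imset => x y /setD1P [_ xX] /setD1P [_ yX]; apply: injf.
have dTD : [disjoint T & D].
  rewrite -setI_eq0; apply/eqP/setP => z; rewrite [z \in set0]inE; apply/negP.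
  case/setIP => /imsetP [x /setD1P [nx xX] ->] /set2P [/injf exx|fxy].
    by case/eqP: nx; apply: exx.
  by have := fN x xX; rewrite fxy y0N.
have TDY : T :|: D \subset Y by rewrite !subUset TY !sub1set fY.
have cTD : #|T :|: D| = #|X|.+1.
  by rewrite cardsU (disjoint_setI0 dTD) cards0 subn0 cT cards2 nfy cX addn2.
have cR : #|Y :\: (T :|: D)| + #|X|.+1 = #|Y|.
  by rewrite -(cardsID (T :|: D) Y) (setIidPr TDY) cTD addnC.
(* The parts [T], [D] and the rest of [Y] have [#|X| - 1], 2 and [#|Y| - #|X| - 1] vertices. All are
   even, so the separate matchings together cover [Y]. *)
have [P hP cP] := packing_exists _ (X :\ x0).
have [Q1 hQ1 cQ1] := packing_exists _ T.
have [Q2 hQ2 cQ2] := packing_exists _ (Y :\: (T :|: D)).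
have [hQD cQD] := packing_setU hQ1 (packing_set2 _ _ _ nfy) dTD.
have [] := packing_setU hQD hQ2.
  by rewrite -setI_eq0 setIDA setIC -setIDA setDv setI0.
rewrite -{1}(setIidPr TDY) setID => hQ cQ.
have hP' : packing P X.
  by have [? ? sP] := hP; split=> //; apply: subset_trans sP (subsetDl _ _).
pose g x := if x == x0 then y0 else f x.
have nfy0 x : x \in X -> f x != y0.
  by move=> xX; apply: contraTneq y0N => <-; apply: fN.
have [] := stable_packings_cross _ _ _ g _ _ XY dXY hP' hQ.
- move=> x y xX yX; rewrite /g.
  case: eqP => [->|_]; case: eqP => [-> //|_]; last exact: injf.
    by move=> e; have := nfy0 y yX; rewrite -e eqxx.
  by move=> e; have := nfy0 x xX; rewrite e eqxx.
- by move=> x xX; rewrite /g; case: eqP => // _; apply: fY.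
(* [P] avoids [x0], so [g] agrees with [f] on [cover P] and the neighbours of [y0] in [X] do no
   harm. *)
- move=> x xP; have [_ _ /subsetP /(_ _ xP) /setD1P [nx xX]] := hP.
  by rewrite /g (negPf nx) fN.
- move=> x y xX.
  have gTD : g x \in T :|: [set y0].
    rewrite /g; case: eqP => [_|/eqP nx]; first by rewrite setUC setU11.
    by rewrite inE imset_f // !inE nx.
  case/setUP => [/setUP [yQ|/set1P yD]|yQ].
  + have [_ _ /subsetP sQ1] := hQ1.
    have /imsetP [z /setD1P [_ zX] ->] : y \in T.
      by apply: sQ1; apply/bigcupP; exists [set g x; y]; rewrite ?set22.
    exact: fN.
  (* Here the pair is [D], whose only vertex among the values of [g] is [y0]; hence [y] is
     [f x0]. *)
  + have gD : g x = y0.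
      case/setUP: gTD => [gT|/set1P //].
      have : g x \in D by rewrite /D -yD set21.
      by rewrite (disjointFr dTD gT).
    rewrite gD in yD.
    have -> : y = f x0; last exact: fN.
    apply: (set2_injr _ y0); last by rewrite yD setUC.
    by rewrite yD cards2 nfy.
  + have [_ _ /subsetP sQ2] := hQ2.
    have : g x \in Y :\: (T :|: D).
      by apply: sQ2; apply/bigcupP; exists [set g x; y]; rewrite ?set21.
    rewrite inE => /andP [/negP []].
    by apply: subsetP (g x) gTD; rewrite setUS // sub1set set22.
move=> pE sE cE; eexists; split; [exact: pE|exact: sE|].
rewrite cE cP cQ cQD cQ1 cQ2 cT cards1; lia.
Qed.

Theorem theorem6p6 (G : sgraph) (X Y : {set G}) (m n : nat)
    (hG : two_clique_graph X Y m n)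
    (hnbr : #|[set y in Y | has_neighbour_in X y]| <= n - m)
    (hconn : connected G)
    (heven : ~~ odd n \/ ~~ odd m) :
  ~ well_covered (token_graph2 G).
Proof.
case: hG => XY dXY [cX cY] [kX kY] /andP [m0 mn] wc; subst m n.
have [x0 [y0 [x0X y0Y x0y0]]] :=
  connected_cross_edge _ _ _ hconn XY dXY m0 (leq_trans m0 mn).
have hfree : #|X| <= #|[set y in Y | ~~ has_neighbour_in X y]|.
  have := cardsID [set y | has_neighbour_in X y] Y.
  have -> : Y :\: [set y | has_neighbour_in X y] = [set y in Y | ~~ has_neighbour_in X y].
    by apply/setP => y; rewrite !inE andbC.
  by rewrite -setIdE; lia.
have [S1 mS1 leS1] := full_maximal_independent _ _ _ _ _ XY dXY hfree x0X y0Y x0y0 heven.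
(* [S1] reaches the sum of these bounds, so a strict inequality inside either clique forces a size
   below that of [S1]. *)
have bound (S : {set token_graph2 G}) : maximal_independent S ->
    [/\ #|S| <= #|[set A in val @: S | A \subset X]| +
                #|[set A in val @: S | A \subset Y]| + #|X|,
        #|[set A in val @: S | A \subset X]| <= #|X|./2
      & #|[set A in val @: S | A \subset Y]| <= #|Y|./2].
  move=> /maxsetp /independent_stable sS; have pS := token_set_pairs _ S.
  split.
  - by rewrite -(card_imset S val_inj); apply: stable_card_leq.
  - exact: packing_leq (stable_clique_packing _ _ _ kX pS sS).
  - exact: packing_leq (stable_clique_packing _ _ _ kY pS sS).
(* Parity supplies [z1]: a nonempty set of even size has a second element. *)
have other (Z : {set G}) z : z \in Z -> ~~ odd #|Z| -> exists2 z', z' \in Z & z != z'.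
  move=> zZ eZ; have /card_gt0P [z' /setD1P [nz z'Z]] : 0 < #|Z :\ z|.
    by have := cardsD1 z Z; rewrite zZ; lia.
  by exists z' => //; rewrite eq_sym.
(* The even clique plays the role of [Z], and the end of the crossing edge outside it is [w]. *)
case: heven => [eY|eX].
  have [y1 y1Y ny] := other _ _ y0Y eY.
  have [||S2 mS2 ltS2] := deficient_maximal_independent _ _ y0 y1 x0 kY eY y0Y y1Y ny.
  - by rewrite (disjointFr dXY).
  - by rewrite adj_sym.
  by have [] := bound _ mS2; rewrite (wc _ _ mS2 mS1); lia.
have [x1 x1X nx] := other _ _ x0X eX.
have [||S2 mS2 ltS2] := deficient_maximal_independent _ _ x0 x1 y0 kX eX x0X x1X nx.
- by rewrite (disjointFl dXY).
- by [].
by have [] := bound _ mS2; rewrite (wc _ _ mS2 mS1); lia.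
Qed.
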